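(* Let $K$ be a compact group with an irreducible unitary representation on a finite-dimensional complex vector space $V$, put $N = \dim V \geq 2$ and $u = \dim U$ for a nonzero subspace $U \leq V$. Then $$\mathrm{diam}_+^{K}(V, U) \leq \min\Bigl\{ \Bigl\lceil \frac{N \ln N}{u} \Bigr\rceil, \quad \frac{N(1 + \ln u)}{u} + 1, \quad N - u + 1 \Bigr\}.$$
   Context: For a group $H$ with a linear representation $\rho$ on a finite-dimensional complex vector space $V$ and a nonzero subspace $U \leq V$, the group-additive diameter is $$\mathrm{diam}_+^{H}(V,U) = \min\{ m \mid \rho(g_1)\cdot U + \dots + \rho(g_m)\cdot U = V \text{ for some } g_1,\dots,g_m \in H\},$$ which is $\infty$ if no such $m$ exists. Representations of compact groups are continuous. *)

(* Defs.v *)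
From HB Require Import structures.
From mathcomp Require Import all_boot all_order all_algebra.
From mathcomp Require Import all_classical all_reals all_analysis.
From mathcomp Require Import complex.

Set Implicit Arguments.
Unset Strict Implicit.
Unset Printing Implicit Defensive.

Import Order.TTheory GRing.Theory Num.Theory.
Import numFieldNormedType.Exports.

Local Open Scope classical_set_scope.
Local Open Scope ring_scope.

HB.mixin Record isTopologicalGroup K of Group K & Topological K := {
  mulg_continuous : continuous (fun xy : K * K => (xy.1 * xy.2)%g) ;
  invg_continuous : continuous (fun x : K => x^-1%g)
}.

#[short(type="topologicalGroupType")]
HB.structure Definition TopologicalGroup :=
  {K of isTopologicalGroup K & Group K & Topological K}.

Section Representation.
Variables (R : realType) (H : groupType) (V : vectType R[i]).
Implicit Types (rho : H -> 'End(V)) (U : {vspace V}).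

Definition representation rho : Prop :=
  rho 1%g = \1%VF /\ forall g h, rho (g * h)%g = (rho g \o rho h)%VF.

Definition irreducible rho : Prop :=
  {:V}%VS != 0%VS /\
  forall W : {vspace V}, (forall g, (rho g @: W <= W)%VS) ->
    W = 0%VS \/ W = {:V}%VS.

Definition unitary (form : {dot V for Num.conj}) rho : Prop :=
  forall g, isometry form form (rho g).

(* As a set of naturals, the set below contains its infimum when it is
   nonempty; the infimum of the empty set is +oo. *)
Definition diam_add rho U : \bar R :=
  ereal_inf [set m%:R%:E | m in
    [set m : nat | exists g : 'I_m -> H,
       (\sum_(i < m) (rho (g i) @: U))%VS = {:V}%VS]].

End Representation.

(* Continuity of the matrix of [rho g] in a basis of [V], for the usual topology
   on complex matrices ([R[i]^o] carries the topology of the complex modulus).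
   Another basis conjugates these matrices by a fixed one, so the choice of
   basis is immaterial. *)
Definition continuous_representation (R : realType) (K : topologicalGroupType)
    (V : vectType R[i]) (rho : K -> 'End(V)) : Prop :=
  continuous (fun g =>
    passmx.mxof (vbasis {:V}) (vbasis {:V}) (rho g) : 'M[R[i]^o]_(\dim {:V})).

(* Main.v *)
Require Import Defs.
From HB Require Import structures.
From mathcomp Require Import all_boot all_order all_algebra.
From mathcomp Require Import all_classical all_reals all_analysis.
From mathcomp Require Import complex lra ring zify.
Import Order.TTheory GRing.Theory Num.Theory.
Import numFieldNormedType.Exports.
Local Open Scope classical_set_scope.
Local Open Scope ring_scope.

(** Write [N = \dim V], [u = \dim U].  Everything follows from one step: for
    every subspace [W] some translate of [U] satisfies
      codim (W + g U) * N <= codim W * (N - u),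
    that is, adding a well-chosen translate multiplies the codimension by at
    most [1 - u / N] ([exists_large_translate]).  Choosing translates greedily
    from [W = 0] gives codimensions [c k] with [c 0 = N] that decay at least
    geometrically and, being integers, drop by at least one as long as they are
    positive.  The three bounds are three ways of reaching [c m = 0]: wait until
    [N * exp (- u m / N)], a strict upper bound of [c m] for [m > 0], is at most [1]
    ([decay_ceil]); wait until the codimension is at most [N / u], then go down
    one by one ([decay_ln]); go down one by one from [c 1 <= N - u]
    ([decay_linear]).

    For the step, let [P] be the orthogonal projector onto the complement of [W]
    and [Q] the one onto [U].  The trace of [P (g Q g^-1)] is a lower bound for
    [dim (W + g U) - dim W] ([retr_orthoproj_le], applied to [g U] inside
    [W + g U]), and an average over the group would make [g Q g^-1] a scalar
    matrix by Schur's lemma, hence of trace against [P] equal to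
    [codim W * u / N]; so some [g] does at least as well as the average.  The
    average is taken here by convexity instead of integration, on the side of
    [P].  The matrices [Y] with [Re (tr Y) >= codim W] and
    [Re (tr (Y (g Q g^-1))) <= t] for all [g] form a closed convex set that is
    stable under conjugation by the group.  Its point of least Hilbert-Schmidt
    norm is unique, hence fixed by conjugation, hence a scalar matrix
    ([scalar_solution]).  If every translate were too small, [P] would lie in
    this set for some [t < codim W * u / N], whereas no scalar matrix does. *)

Set Implicit Arguments.
Unset Strict Implicit.
Unset Printing Implicit Defensive.

Local Open Scope sesquilinear_scope.

(** * Least-norm solutions of systems of linear inequalities *)

Lemma coercive_min (R : realType) n (A : set 'rV[R]_n) (f : 'rV[R]_n -> R) :
    closed A -> A !=set0 -> continuous f ->
    (forall (v : 'rV[R]_n) i, v 0 i ^+ 2 <= f v) ->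
  exists2 v, A v & forall w, A w -> f v <= f w.
Proof.
move=> clA [v0 Av0] cf f_ge.
pose b := f v0 + 1.
pose B := [set v : 'rV[R]_n | forall i, `[- b, b]%classic (v 0 i)].
have cB : compact B.
  by apply: (@rV_compact _ _ (fun=> `[- b, b]%classic)) => _; exact: segment_compact.
have inB v : f v <= f v0 -> B v.
  move=> le_f i; rewrite /= in_itv /= -ler_norml.
  have := f_ge v i; rewrite -real_normK ?num_real //; have := normr_ge0 (v 0 i).
  rewrite /b; nra.
have cAB : compact (A `&` B) by rewrite setIC; exact: compact_closedI.
have [||v /set_mem[Av Bv] vmin] := @compact_EVT_min _ R f (A `&` B) _ cAB.
- by exists v0; split => //; exact: (inB v0).
- exact: continuous_subspaceT.
exists v => // w Aw; have [/inB Bw|/ltW le_w] := leP (f w) (f v0).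
  by apply: vmin; rewrite inE.
apply: le_trans le_w; apply: vmin; rewrite inE; split => //; exact: inB.
Qed.

Section HilbertSchmidt.
Variables (R : realType) (n : nat).
Implicit Types X Y A : 'M[R[i]]_n.

(** The system of constraints on [Y] considered below consists of bounds on
    [retr (Y *m A)]: these are all the real-linear forms on complex matrices. *)
Definition retr X : R := complex.Re (\tr X).
Definition sqn Y : R := retr (Y *m Y^t*).

Lemma complex_ReM (x y : R[i]) : complex.Re (x * y) =
  complex.Re x * complex.Re y - complex.Im x * complex.Im y.
Proof. by case: x y => [a b] [c d]. Qed.

Lemma complex_Re_sum (I : finType) (F : I -> R[i]) :
  complex.Re (\sum_i F i) = \sum_i complex.Re (F i).
Proof. exact: (raddf_sum (@complex.Re R : Rcomplex R -> R)). Qed.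

Lemma retr_mulE Y A : retr (Y *m A) = \sum_i \sum_j
  (complex.Re (Y i j) * complex.Re (A j i)
     - complex.Im (Y i j) * complex.Im (A j i)).
Proof.
rewrite /retr /mxtrace complex_Re_sum; apply: eq_bigr => i _; rewrite mxE complex_Re_sum.
by apply: eq_bigr => j _; rewrite complex_ReM.
Qed.

Lemma sqnE Y :
  sqn Y = \sum_i \sum_j (complex.Re (Y i j) ^+ 2 + complex.Im (Y i j) ^+ 2).
Proof.
rewrite /sqn retr_mulE; apply: eq_bigr => i _; apply: eq_bigr => j _.
by rewrite !mxE; case: (Y i j) => a b /=; rewrite ?/Num.conj /=; ring.
Qed.

(** The topological argument takes place in a real coordinate space, where the
    bounded closed sets are compact. *)
Definition mx_of_coords (v : 'rV[R]_(n * n + n * n)) : 'M[R[i]]_n :=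
  \matrix_(i, j) (v 0 (lshift _ (mxvec_index i j))
             +i* v 0 (rshift _ (mxvec_index i j)))%C.

Lemma mx_of_coords_surj Y : exists v, mx_of_coords v = Y.
Proof.
exists (row_mx (mxvec (map_mx (@complex.Re R) Y)) (mxvec (map_mx (@complex.Im R) Y))).
apply/matrixP => i j; rewrite mxE row_mxEl row_mxEr !mxvecE !mxE.
by case: (Y i j).
Qed.

(** A solution set is closed, so it meets a large enough ball in a compact set,
    on which the norm attains its minimum. *)
Lemma min_norm (D : set ('M[R[i]]_n * R)) :
    (exists Y, forall c, D c -> retr (Y *m c.1) <= c.2) ->
  exists2 Y, forall c, D c -> retr (Y *m c.1) <= c.2 &
    forall Z, (forall c, D c -> retr (Z *m c.1) <= c.2) -> sqn Y <= sqn Z.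
Proof.
move=> [Y0 Y0D].
have cRe i j : continuous (fun v => complex.Re (mx_of_coords v i j)).
  under eq_fun do rewrite mxE /=.
  exact: coord_continuous.
have cIm i j : continuous (fun v => complex.Im (mx_of_coords v i j)).
  under eq_fun do rewrite mxE /=.
  exact: coord_continuous.
have sum_cont (F : 'I_n -> 'I_n -> 'rV[R]_(n * n + n * n) -> R) :
    (forall i j, continuous (F i j)) ->
    continuous (fun v => \sum_i \sum_j F i j v).
  move=> cF; apply: (continuous_big add_continuous) => i _.
  by apply: (continuous_big add_continuous).
have ctr A : continuous (fun v => retr (mx_of_coords v *m A)).
  under eq_fun do rewrite retr_mulE.
  apply: (sum_cont (fun i j v =>
    complex.Re (mx_of_coords v i j) * complex.Re (A j i)
    - complex.Im (mx_of_coords v i j) * complex.Im (A j i))) => i j v.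
  exact: (cvgB (cvgM (cRe i j v) (cvg_cst _)) (cvgM (cIm i j v) (cvg_cst _))).
have csq : continuous (fun v => sqn (mx_of_coords v)).
  under eq_fun do rewrite sqnE.
  apply: (sum_cont (fun i j v => complex.Re (mx_of_coords v i j) ^+ 2
    + complex.Im (mx_of_coords v i j) ^+ 2)) => i j v.
  exact: (cvgD (cvgM (cRe i j v) (cRe i j v)) (cvgM (cIm i j v) (cIm i j v))).
pose S := \bigcap_(c in D) [set v | retr (mx_of_coords v *m c.1) <= c.2].
have clS : closed S.
  apply: closed_bigI => c _.
  apply: (@closed_comp _ _ (fun v => retr (mx_of_coords v *m c.1)) [set x | x <= c.2]).
    by move=> v _; exact: ctr.
  exact: closed_le.
have [||v Sv vmin] := @coercive_min R _ S _ clS _ csq.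
- by have [v vY] := mx_of_coords_surj Y0; exists v => c /Y0D; rewrite /= vY.
- move=> v k; rewrite sqnE.
  have ge0 (i j : 'I_n) : 0 <= complex.Re (mx_of_coords v i j) ^+ 2
                                 + complex.Im (mx_of_coords v i j) ^+ 2.
    by rewrite addr_ge0 ?sqr_ge0.
  suff [i [j vk]] : exists i j, v 0 k ^+ 2 <=
    complex.Re (mx_of_coords v i j) ^+ 2 + complex.Im (mx_of_coords v i j) ^+ 2.
    apply: le_trans vk _; rewrite (bigD1 i) //= (bigD1 j) //= -addrA lerDl.
    by rewrite addr_ge0 ?sumr_ge0 // => i' _; rewrite sumr_ge0.
  rewrite -[k]splitK; case: (fintype.split k) => {}k; case/mxvec_indexP: k => i j;
    by exists i, j; rewrite !mxE /= ?lerDl ?lerDr sqr_ge0.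
exists (mx_of_coords v) => [c Dc|Z ZD]; first exact: Sv.
by have [w wZ] := mx_of_coords_surj Z; rewrite -wZ; apply: vmin => c /ZD; rewrite -wZ.
Qed.

Lemma complex_Re_nat k : complex.Re (k%:R : R[i]) = k%:R.
Proof. by rewrite -(rmorph_nat (real_complex R)). Qed.

Lemma complex_Im_nat k : complex.Im (k%:R : R[i]) = 0.
Proof. by rewrite -(rmorph_nat (real_complex R)). Qed.

Lemma complex_ReD (x y : R[i]) : complex.Re (x + y) = complex.Re x + complex.Re y.
Proof. by case: x y => [a b] [c d]. Qed.

Lemma complex_ReN (x : R[i]) : complex.Re (- x) = - complex.Re x.
Proof. by case: x => [a b]. Qed.

Lemma retrD X Y : retr (X + Y) = retr X + retr Y.
Proof. by rewrite /retr mxtraceD complex_ReD. Qed.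

Lemma retrN X : retr (- X) = - retr X.
Proof. by rewrite /retr raddfN complex_ReN. Qed.

Lemma retrZ (a : R) X : retr (a%:C%C *: X) = a * retr X.
Proof. by rewrite /retr mxtraceZ complex_ReM /= mul0r subr0. Qed.

Lemma retrC X Y : retr (X *m Y) = retr (Y *m X).
Proof. by rewrite /retr mxtrace_mulC. Qed.

Lemma retr_scalar (a : R[i]) : retr (a%:M : 'M[R[i]]_n) = n%:R * complex.Re a.
Proof.
rewrite /retr mxtrace_scalar mulr_natl.
by elim: n => [|m IH] //; rewrite !mulrS complex_ReD IH.
Qed.

Lemma sqn_ge0 Y : 0 <= sqn Y.
Proof.
by rewrite sqnE; do 2!apply: sumr_ge0 => ? _; rewrite addr_ge0 ?sqr_ge0.
Qed.

Lemma sqn_le0 Y : sqn Y <= 0 -> Y = 0.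
Proof.
have ge0 i j : 0 <= complex.Re (Y i j) ^+ 2 + complex.Im (Y i j) ^+ 2.
  by rewrite addr_ge0 ?sqr_ge0.
move=> Y_le0; have /eqP : sqn Y == 0 by rewrite eq_le Y_le0 sqn_ge0.
rewrite sqnE => /psumr_eq0P Y0; apply/matrixP => i j; rewrite mxE.
have /psumr_eq0P Yi0 := Y0 (fun i _ => sumr_ge0 _ (fun j _ => ge0 i j)) i isT.
have /eqP := Yi0 (fun j _ => ge0 i j) j isT.
rewrite paddr_eq0 ?sqr_ge0 // !sqrf_eq0 => /andP[/eqP re0 /eqP im0].
by move: re0 im0; case: (Y i j) => a b /= -> ->.
Qed.

Lemma sqn_parallelogram X Y : sqn (X - Y) + sqn (X + Y) = 2 * (sqn X + sqn Y).
Proof.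
rewrite /sqn !linearD !linearN /= !map_mxD !map_mxN !mulmxDl !mulmxDr !mulNmx !mulmxN.
by rewrite !retrD !retrN opprK; ring.
Qed.

Lemma sqn_half Y : sqn ((2^-1 : R)%:C%C *: Y) = 4^-1 * sqn Y.
Proof.
rewrite /sqn linearZ /= map_mxZ -scalemxAl -scalemxAr scalerA.
have -> : ((2^-1 : R)%:C * Num.conj ((2^-1 : R)%:C) = (4^-1 : R)%:C)%C.
  by apply/eqP; rewrite eq_complex /=; apply/andP; split; apply/eqP; field.
by rewrite retrZ.
Qed.

Lemma unitarymx_mulCl (s : 'M[R[i]]_n) : s \is unitarymx -> s^t* *m s = 1%:M.
Proof. by move/unitarymxP/mulmx1C. Qed.

Lemma sqn_unitary (s Y : 'M[R[i]]_n) : s \is unitarymx ->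
  sqn (s *m Y *m s^t*) = sqn Y.
Proof.
move=> s_u; rewrite /sqn !trmx_mul !map_mxM trmxCK !mulmxA mulmxKtV //.
by rewrite retrC !mulmxA (unitarymx_mulCl s_u) mul1mx.
Qed.

(** * Systems stable under unitary conjugation *)

Variables (S : set 'M[R[i]]_n) (D : set ('M[R[i]]_n * R)).
Hypothesis S_unitary : forall s, S s -> s \is unitarymx.
Hypothesis D_inv : forall s A b, S s -> D (A, b) -> D (s^t* *m A *m s, b).
Hypothesis D_sol : exists Y, forall c, D c -> retr (Y *m c.1) <= c.2.

(** The least-norm solution is unique: the midpoint of two of them is a solution
    too, and would be shorter by the parallelogram law.  Conjugation by [S]
    preserves both the solutions and the norm, so it fixes that point. *)
Lemma commuting_solution :
  exists2 Y, forall c, D c -> retr (Y *m c.1) <= c.2 &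
    forall s, S s -> s *m Y = Y *m s.
Proof.
have [Y YD Ymin] := min_norm D_sol; exists Y => // s Ss.
pose Y' := s *m Y *m s^t*.
have Y'D c : D c -> retr (Y' *m c.1) <= c.2.
  case: c => A b /(D_inv Ss) /YD /=.
  rewrite /Y' -[s *m Y *m _ *m _]mulmxA -[s *m Y *m _]mulmxA.
  by rewrite [retr (s *m _)]retrC -!mulmxA.
pose Z := (2^-1 : R)%:C%C *: (Y + Y').
have ZD c : D c -> retr (Z *m c.1) <= c.2.
  move=> Dc; rewrite /Z -scalemxAl retrZ mulmxDl retrD.
  by have := YD c Dc; have := Y'D c Dc; lra.
have := Ymin Z ZD; rewrite sqn_half => min_le.
have := sqn_parallelogram Y Y'; rewrite [sqn Y']sqn_unitary ?S_unitary // => par.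
have /sqn_le0/eqP : sqn (Y - Y') <= 0 by lra.
rewrite subr_eq0 => /eqP eqY.
by rewrite [in RHS]eqY /Y' mulmxKtV ?S_unitary.
Qed.

End HilbertSchmidt.

(** * Orthogonal projectors *)

Section Projector.
Variables (C : numClosedFieldType) (n : nat).

(** The projector onto the row space of [A], written with an orthonormal basis of
    rows so that its trace is visible.  It is locked because it would otherwise
    be unfolded by rewriting rules on products. *)
Definition orthoproj m (A : 'M[C]_(m, n)) : 'M[C]_n :=
  locked ((schmidt (row_base A))^t* *m schmidt (row_base A)).

Variables (m : nat) (A : 'M[C]_(m, n)).

Let B := schmidt (row_base A).

Let B_unitary : B \is unitarymx.
Proof. by rewrite schmidt_unitarymx ?rank_leq_col. Qed.

Let B_eq : (B :=: A)%MS.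
Proof. exact: eqmx_trans (eqmx_schmidt_free (row_base_free A)) (eq_row_base A). Qed.

Lemma orthoproj_herm : (orthoproj A)^t* = orthoproj A.
Proof. by rewrite /orthoproj -lock trmx_mul map_mxM trmxCK. Qed.

Lemma orthoproj_sub : (orthoproj A <= A)%MS.
Proof. by rewrite /orthoproj -lock -B_eq submxMl. Qed.

Lemma orthoproj_id p (X : 'M[C]_(p, n)) : (X <= A)%MS -> X *m orthoproj A = X.
Proof.
rewrite -B_eq => /submxP[Y ->]; rewrite /orthoproj -lock !mulmxA -/B.
by rewrite mulmxtVK.
Qed.

Lemma mxtrace_orthoproj : \tr (orthoproj A) = (\rank A)%:R.
Proof.
by rewrite /orthoproj -lock mxtrace_mulC -/B (unitarymxP B_unitary) mxtrace1.
Qed.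

End Projector.

Section ProjectorTrace.
Variables (R : realType) (n : nat).

Lemma retr_orthoproj m (A : 'M[R[i]]_(m, n)) : retr (orthoproj A) = (\rank A)%:R.
Proof. by rewrite /retr mxtrace_orthoproj complex_Re_nat. Qed.

(** This real part is the squared Hilbert-Schmidt norm of [Q *m P]. *)
Lemma retr_proj_ge0 (P Q : 'M[R[i]]_n) : P^t* = P -> P *m P = P ->
  Q^t* = Q -> Q *m Q = Q -> 0 <= retr (P *m Q).
Proof.
move=> Ph PP Qh QQ; suff -> : retr (P *m Q) = sqn (Q *m P) by exact: sqn_ge0.
rewrite /sqn trmx_mul map_mxM Ph Qh mulmxA -(mulmxA Q P P) PP.
by rewrite [RHS]retrC mulmxA QQ retrC.
Qed.

(** The difference [orthoproj T - Q] is itself an orthogonal projector. *)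
Lemma retr_orthoproj_le m (P Q : 'M[R[i]]_n) (T : 'M[R[i]]_(m, n)) :
    P^t* = P -> P *m P = P -> Q^t* = Q -> Q *m Q = Q -> (Q <= T)%MS ->
  retr (P *m Q) <= retr (P *m orthoproj T).
Proof.
move=> Ph PP Qh QQ QT; pose E := orthoproj T.
have QE : Q *m E = Q by rewrite orthoproj_id.
have EQ : E *m Q = Q.
  by rewrite -[RHS]Qh -[in RHS]QE trmx_mul map_mxM Qh orthoproj_herm.
have EE : E *m E = E by rewrite orthoproj_id ?orthoproj_sub.
rewrite -subr_ge0 -retrN -retrD -mulmxN -mulmxDr; apply: retr_proj_ge0 => //.
  by rewrite linearB /= map_mxB orthoproj_herm Qh.
by rewrite mulmxBl !mulmxBr EE QE EQ QQ subrr subr0.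
Qed.

End ProjectorTrace.

(** * Irreducible sets of unitary matrices *)

Section Step.
Variables (R : realType) (n : nat) (S : set 'M[R[i]]_n).
Hypothesis S_unitary : forall s, S s -> s \is unitarymx.
Hypothesis S_one : S 1%:M.
Hypothesis S_mul : forall s t, S s -> S t -> S (s *m t).
Hypothesis S_irr : forall W : 'M[R[i]]_n,
  (forall s, S s -> (W *m s <= W)%MS) -> W = 0 \/ row_full W.
Hypothesis n_gt0 : (0 < n)%N.

(** Schur's lemma: an eigenspace of [Y] is stable under [S]. *)
Lemma scalar_commutant Y : (forall s, S s -> s *m Y = Y *m s) ->
  exists a, Y = a%:M.
Proof.
move=> sY; have [a aY] := eigenvalue_closed Y n_gt0; exists a.
have [s Ss||] := S_irr (W := eigenspace Y a).
- apply/eigenspaceP; rewrite -mulmxA sY // mulmxA.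
  by rewrite (eigenspaceP (submx_refl _)) -scalemxAl.
- by move/eqP; rewrite (negPf aY).
- rewrite -sub1mx => /eigenspaceP; rewrite mul1mx => ->.
  by rewrite scalemx1.
Qed.

(** This replaces averaging over the group: instead of the mean of the conjugates
    of a solution, it provides a solution that is invariant for being shortest. *)
Lemma scalar_solution (D : set ('M[R[i]]_n * R)) :
    (forall s A b, S s -> D (A, b) -> D (s^t* *m A *m s, b)) ->
    (exists Y, forall c, D c -> retr (Y *m c.1) <= c.2) ->
  exists a : R[i], forall c, D c -> retr (a%:M *m c.1) <= c.2.
Proof.
move=> D_inv D_sol; have [Y YD sY] := commuting_solution S_unitary D_inv D_sol.
by have [a Ya] := scalar_commutant sY; exists a; rewrite -Ya; exact: YD.
Qed.

(** Matrices act on row vectors on the right, so that [U *m s] is the translate of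
    the row space of [U] by [s], and [s^t* *m orthoproj U *m s] is the orthogonal
    projector onto it. *)
Lemma exists_large_sum m p (W : 'M[R[i]]_(m, n)) (U : 'M[R[i]]_(p, n)) :
  exists2 s, S s &
    ((n - \rank (W + U *m s)%MS) * n <= (n - \rank W) * (n - \rank U))%N.
Proof.
apply: contrapT => noS.
(* If every translate is too small, then [t / n] bounds the trace of the projector
   onto the complement of [W] times the one onto any translate of [U]; the [- 1]
   comes from a strict inequality between integers. *)
pose t : R := ((n - \rank W) * \rank U)%:R - 1.
pose D := [set c : 'M[R[i]]_n * R | c = (- 1%:M, - (n - \rank W)%:R) \/
  exists2 s, S s & c = (s^t* *m orthoproj U *m s, t / n%:R)].
have [||a aD] := @scalar_solution D.
- move=> s A b Ss [[-> ->]|[r Sr [-> ->]]].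
    by left; rewrite mulmxN mulmx1 mulNmx unitarymx_mulCl ?S_unitary.
  right; exists (r *m s); first exact: S_mul.
  by rewrite trmx_mul map_mxM !mulmxA.
- pose E := orthoproj W; pose P := 1%:M - E.
  have EE : E *m E = E by rewrite orthoproj_id ?orthoproj_sub.
  have PP : P *m P = P.
    by rewrite mulmxBl !mulmxBr !mul1mx mulmx1 EE subrr subr0.
  have Ph : P^t* = P.
    by rewrite linearB /= map_mxB trmx1 map_mx1 orthoproj_herm.
  exists P => c [->/=|[s Ss ->/=]].
    rewrite mulmxN mulmx1 retrN retrD retrN retr_orthoproj retr_scalar /=.
    by rewrite natrB ?rank_leq_col // mulr1.
  pose T := (W + U *m s)%MS.
  have rT : (n * (\rank T - \rank W) < (n - \rank W) * \rank U)%N.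
    have := contra_not (ex_intro2 _ _ s Ss) noS; move/negP; rewrite -/T -ltnNge.
    have := rank_leq_col T; have := rank_leq_col U.
    have := mxrankS (addsmxSl W (U *m s)); rewrite -/T.
    nia.
  apply: le_trans (_ : (\rank T - \rank W)%:R <= _).
    have -> : (\rank T - \rank W)%:R = retr (P *m orthoproj T).
      rewrite mulmxBl mul1mx orthoproj_id; last first.
        exact: submx_trans (orthoproj_sub _) (addsmxSl _ _).
      by rewrite retrD retrN !retr_orthoproj natrB // mxrankS ?addsmxSl.
    have ss := unitarymxP (S_unitary Ss).
    apply: retr_orthoproj_le => //.
    + by rewrite trmx_mul map_mxM trmx_mul map_mxM trmxCK orthoproj_herm mulmxA.
    + rewrite !mulmxA -[_ *m s *m s^t*]mulmxA ss mulmx1.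
      by rewrite -[_ *m orthoproj U *m orthoproj U]mulmxA orthoproj_id ?orthoproj_sub.
    + rewrite -mulmxA (submx_trans (submxMl _ _)) //.
      by rewrite (submx_trans _ (addsmxSr _ _)) // submxMr ?orthoproj_sub.
  rewrite /t ler_pdivlMr ?ltr0n // lerBrDr -natrM natr1 ler_nat.
  by rewrite mulnC.
(* The scalar matrix [a%:M] solving the system satisfies
   [n Re a >= n - \rank W] and [Re a * \rank U <= t / n], which is absurd. *)
have := aD (- 1%:M, - (n - \rank W)%:R) (or_introl erefl).
have := aD _ (or_intror (ex_intro2 _ _ _ S_one erefl)).
rewrite /= trmx1 map_mx1 mul1mx mulmx1 mulmxN mulmx1 retrN retr_scalar.
rewrite mul_scalar_mx /retr mxtraceZ mxtrace_orthoproj.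
rewrite complex_ReM complex_Re_nat complex_Im_nat mulr0 subr0 lerN2 => le1 le2.
have n0 : 0 < n%:R :> R by rewrite ltr0n.
move: le1; rewrite ler_pdivlMr // /t natrM => le1.
have := ler_wpM2r (ler0n R (\rank U)) le2; lra.
Qed.
End Step.

(** * Unitary representations in coordinates *)

(** An orthonormal family that does not span is extended by the normalized
    component, orthogonal to it, of any vector outside its span. *)
Lemma exists_orthonormal_basis (C : numClosedFieldType) (V : vectType C)
    (form : {dot V for Num.conj}) :
  exists2 e : (\dim {:V}).-tuple V, basis_of {:V} e &
    forall i j : 'I_(\dim {:V}), form e`_i e`_j = (i == j)%:R.
Proof.
suff [S [on_S size_S]] : exists S : seq V, orthonormal form S /\ size S = \dim {:V}.
  exists (tcast size_S (in_tuple S)).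
    by rewrite basisEfree val_tcast /= (orthonormal_free on_S) subvf size_S leqnn.
  move=> i j; rewrite val_tcast /=; have /orthonormalP[uS oS] := on_S.
  by rewrite oS ?mem_nth ?size_S ?ltn_ord // nth_uniq ?size_S ?ltn_ord.
suff: forall k, (k <= \dim {:V})%N ->
    exists S : seq V, orthonormal form S /\ size S = k by apply.
elim=> [_|k IH k_lt]; first by exists [::].
have [S [on_S size_S]] := IH (ltnW k_lt).
have /subvPn[b _ bS] : ~~ ({:V} <= <<S>>)%VS.
  apply: contraL k_lt => /dimvS le_dim.
  by rewrite -leqNgt (leq_trans le_dim) // -size_S dim_span.
have [X XS [Y [bXY _ YS]]] := orthogonal_split form S b.
have Y0 : Y != 0 by apply: contraNneq bS => Y0; rewrite bXY Y0 addr0.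
pose c := (sqrtC (form Y Y))^-1.
exists (c *: Y :: S); split; last by rewrite /= size_S.
have nc : form (c *: Y) (c *: Y) = 1.
  rewrite dnormZ normfV exprVn (ger0_norm (sqrt_dnorm_ge0 _ _)) sqrtCK.
  by rewrite mulVf // dnorm_eq0.
apply/orthonormalP; have /orthonormalP[uS oS] := on_S.
have oYS x : x \in S -> form (c *: Y) x = 0.
  by move=> xS; rewrite linearZl_LR /= (orthoPl YS _ xS) mulr0.
have oSY x : x \in S -> form x (c *: Y) = 0.
  by move=> xS; apply/eqP; rewrite herm_eq0C; apply/eqP; exact: oYS.
have cYS : c *: Y \notin S.
  by apply/negP => /oYS; rewrite nc => /eqP; rewrite oner_eq0.
split; first by rewrite /= cYS.
move=> x y; rewrite !inE => /predU1P[->|xS] /predU1P[->|yS].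
- by rewrite eqxx nc.
- by rewrite oYS //; case: eqP => // cYy; rewrite cYy yS in cYS.
- by rewrite oSY //; case: eqP => // xcY; rewrite -xcY xS in cYS.
- exact: oS.
Qed.

Section Coordinates.
Variables (F : fieldType) (V : vectType F) (e : (\dim {:V}).-tuple V).
Hypothesis e_basis : basis_of {:V} e.
Import passmx.

Lemma mxrank_msof (W : {vspace V}) : \rank (msof e W) = \dim W.
Proof.
pose A : 'M[F]_(\dim W, \dim {:V}) := \matrix_i rVof e (vbasis W)`_i.
have uA u : u *m A = rVof e (\sum_i u 0 i *: (vbasis W)`_i).
  rewrite linear_sum mulmx_sum_row; apply: eq_bigr => i _.
  by rewrite rowK linearZ.
have A_free : row_free A.
  rewrite -kermx_eq0 -submx0; apply/rV_subP => u /sub_kermxP; rewrite uA => /eqP.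
  rewrite rVof_eq0 // => /eqP.
  have /freeP W_free := basis_free (vbasisP W).
  move/W_free => u0; rewrite submx0.
  by apply/eqP/rowP => i; rewrite u0 mxE.
suff eqA : (msof e W :=: A)%MS by rewrite eqA; apply/eqP.
apply/eqmxP/andP; split.
  apply/rV_subP => u; rewrite -mem_vecof // => uW.
  rewrite -[u](vecofK e_basis) (coord_vbasis uW).
  apply/submxP; exists (\row_i coord (vbasis W) i (vecof e u)).
  by rewrite uA; congr rVof; apply: eq_bigr => i _; rewrite mxE.
apply/row_subP => i; rewrite rowK -mem_vecof // rVofK //.
by apply: vbasis_mem; rewrite mem_nth ?size_tuple.
Qed.

Lemma msof_add_img (f : 'End(V)) (W U : {vspace V}) :
  (msof e (W + f @: U)%VS :=: msof e W + msof e U *m mxof e e f)%MS.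
Proof.
apply/eqmxP/andP; split.
  rewrite msof_sub // subv_add -msof_sub // addsmxSl /=.
  apply/subvP => _ /memv_imgP[u uU ->].
  rewrite -rVof_sub // (rVof_app e e_basis).
  rewrite (submx_trans _ (addsmxSr _ _)) // submxMr //.
  by rewrite -mem_vecof // rVofK.
rewrite addsmx_sub sub_msof // addvSl /=.
apply/rV_subP => _ /submxP[v ->]; rewrite -mem_vecof // mulmxA -(hom_vecof e e_basis).
rewrite (subvP (addvSr _ _)) // memv_img //.
by rewrite mem_vecof // submxMl.
Qed.

End Coordinates.

Section UnitaryRep.
Variables (R : realType) (H : groupType) (V : vectType R[i]).
Variables (form : {dot V for Num.conj}) (rho : H -> 'End(V)).
Hypotheses (rho_rep : representation rho) (rho_unitary : unitary form rho).
Hypothesis rho_irr : irreducible rho.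
Import passmx.

Lemma mxof_unitary (e : (\dim {:V}).-tuple V) g : basis_of {:V} e ->
    (forall i j : 'I_(\dim {:V}), form e`_i e`_j = (i == j)%:R) ->
  mxof e e (rho g) \is unitarymx.
Proof.
move=> e_basis e_on.
have formE x y : form x y = (rVof e x *m (rVof e y)^t*) 0 0.
  rewrite {1}(coord_basis e_basis (memvf x)) {1}(coord_basis e_basis (memvf y)).
  rewrite linear_sumlz !mxE; apply: eq_bigr => i _.
  rewrite linearZl_LR /= linear_sumr (bigD1 i) //= big1 ?addr0 => [|j /negPf ji].
    by rewrite linearZr_LR /= e_on eqxx mulr1 !mxE.
  by rewrite linearZr_LR /= e_on eq_sym ji mulr0.
apply/unitarymxP/matrixP => i j.
rewrite [RHS]mxE -e_on [RHS](etrans (esym (rho_unitary g _ _)) (formE _ _)) !mxE.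
apply: eq_bigr => k _.
by rewrite !mxE /= !vecof_delta.
Qed.

(** The step of the greedy construction; coordinates in an orthonormal basis turn
    it into the statement on matrices.  Composition of endomorphisms becomes the
    product of matrices in the opposite order, under which the set of matrices of
    the representation is stable just as well. *)
Lemma exists_large_translate (W U : {vspace V}) :
  exists g, ((\dim {:V} - \dim (W + rho g @: U)%VS) * \dim {:V} <=
             (\dim {:V} - \dim W) * (\dim {:V} - \dim U))%N.
Proof.
have [e e_basis e_on] := exists_orthonormal_basis form.
pose S := range (fun g => mxof e e (rho g)).
have [rho1 rhoM] := rho_rep; have [V0 W_inv] := rho_irr.
have [|||||s [g _ <-]] :=
  @exists_large_sum R (\dim {:V}) S _ _ _ _ _ _ _ (msof e W) (msof e U).
- by move=> _ [g _ <-]; exact: mxof_unitary.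
- by exists 1%g => //; rewrite rho1 mxof1 // (basis_free e_basis).
- move=> _ _ [g _ <-] [h _ <-]; exists (h * g)%g => //.
  by rewrite rhoM (mxof_comp e e e_basis).
- move=> X XS; have [g|X0|Xfull] := W_inv (vsof e X).
  + apply/subvP => _ /memv_imgP[v vX ->].
    rewrite -rVof_sub // (rVof_app e e_basis).
    rewrite (submx_trans _ (XS _ (ex_intro2 _ _ g I erefl))) // submxMr //.
    by rewrite rVof_sub.
  + by left; apply/eqP; rewrite -(vsof_eq0 e_basis) X0.
  + by right; rewrite -sub1mx -(sub_vsof e_basis) Xfull subvf.
- by rewrite lt0n dimv_eq0.
have [rkWU _] := msof_add_img e_basis (rho g) W U.
move=> le_s; exists g.
rewrite -(mxrank_msof e_basis (W + rho g @: U)%VS) rkWU.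
rewrite -(mxrank_msof e_basis W) -(mxrank_msof e_basis U); exact: le_s.
Qed.
End UnitaryRep.

(** * Decay of the codimension *)

Section Decay.
Variables (R : realType) (N u : nat) (c : nat -> nat).
Hypotheses (u_gt0 : (0 < u)%N) (u_le : (u <= N)%N).
Hypothesis c0 : c 0%N = N.
Hypothesis cS : forall k, (c k.+1 * N <= c k * (N - u))%N.

Let N_gt0 : (0 < N)%N. Proof. exact: leq_trans u_le. Qed.

Lemma decay_sub k m : (c (k + m) <= c k - m)%N.
Proof.
elim: m => [|m IH]; first by rewrite addn0 subn0.
rewrite addnS; have := cS (k + m); nia.
Qed.

Lemma decayS k : (c k.+1)%:R <= (c k)%:R * (1 - u%:R / N%:R) :> R.
Proof.
have N0 : 0 < N%:R :> R by rewrite ltr0n.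
rewrite -(ler_pM2r N0) -mulrA mulrBl mul1r divfK ?gt_eqF //.
by rewrite -natrB // -!natrM ler_nat.
Qed.

Lemma decay_expRS k : expR (- (u%:R * k.+1%:R / N%:R)) =
  expR (- (u%:R * k%:R / N%:R)) * expR (- (u%:R / N%:R)) :> R.
Proof. by rewrite -natr1 -expRD -opprD -mulrDl mulrDr mulr1. Qed.

Lemma decay_expR k : (c k)%:R <= N%:R * expR (- (u%:R * k%:R / N%:R)) :> R.
Proof.
elim: k => [|k IH]; first by rewrite mulr0 mul0r oppr0 expR0 mulr1 c0.
apply: le_trans (decayS k) _.
rewrite decay_expRS mulrA.
have le_e := expR_ge1Dx (- (u%:R / N%:R) : R).
apply: le_trans (ler_wpM2l (ler0n _ _) le_e) _.
by rewrite ler_wpM2r // expR_ge0.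
Qed.

(** Strictness, which comes from [1 + x < expR x] for [x != 0] in the last step,
    is what brings the integer [c k] down to [0] when the right-hand side is
    exactly [1]. *)
Lemma decay_expR_lt k : (0 < k)%N ->
  (c k)%:R < N%:R * expR (- (u%:R * k%:R / N%:R)) :> R.
Proof.
case: k => // k _; have N0 : 0 < N%:R :> R by rewrite ltr0n.
apply: le_lt_trans (decayS k) _.
rewrite decay_expRS mulrA.
have lt_e : 1 - u%:R / N%:R < expR (- (u%:R / N%:R) : R).
  by apply: expR_gt1Dx; rewrite oppr_eq0 mulf_neq0 ?invr_eq0 ?pnatr_eq0 -?lt0n.
apply: le_lt_trans (ler_wpM2r _ (decay_expR k)) _.
  by rewrite subr_ge0 ler_pdivrMr // mul1r ler_nat.
by rewrite ltr_pM2l // mulr_gt0 ?expR_gt0.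
Qed.

Lemma decay_ceil : (2 <= N)%N ->
  exists2 m, c m = 0%N & m%:R <= (Num.ceil (N%:R * ln N%:R / u%:R : R))%:~R :> R.
Proof.
move=> N2; set x := _ / _.
have N0 : 0 < N%:R :> R by rewrite ltr0n.
have u0 : 0 < u%:R :> R by rewrite ltr0n.
have x_gt0 : 0 < x by rewrite divr_gt0 // mulr_gt0 // ln_gt0 // ltr1n.
have ceil_gt0 : 0 < Num.ceil x by rewrite ceil_gt0.
exists `|Num.ceil x|%N; last by rewrite natr_absz gtr0_norm.
have m_gt0 : (0 < `|Num.ceil x|)%N by rewrite absz_gt0 gt_eqF.
have x_le : x <= `|Num.ceil x|%:R by rewrite natr_absz gtr0_norm // ceil_ge.
apply/eqP; rewrite -leqn0 -ltnS -(ltr_nat R).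
apply: lt_le_trans (decay_expR_lt m_gt0) _.
rewrite -ler_pdivlMl // mulr1 -[leRHS]lnK ?posrE ?invr_gt0 // ler_expR lnV ?posrE //.
by rewrite lerN2 ler_pdivlMr // -ler_pdivrMl // mulrC [ln _ * _]mulrC.
Qed.

(** After [k >= N ln u / u] steps the codimension is at most [N / u], and [c k]
    further steps bring it to [0]. *)
Lemma decay_ln : exists2 m, c m = 0%N &
  m%:R <= N%:R * (1 + ln u%:R) / u%:R + 1 :> R.
Proof.
have N0 : 0 < N%:R :> R by rewrite ltr0n.
have u0 : 0 < u%:R :> R by rewrite ltr0n.
pose x : R := N%:R * ln u%:R / u%:R.
have x_ge0 : 0 <= x by rewrite divr_ge0 // mulr_ge0 // ln_ge0 // ler1n.
pose k := (Num.truncn x).+1.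
have x_le : x <= k%:R by rewrite ltW // truncnS_gt.
have k_le : k%:R <= x + 1 by rewrite -natr1 lerD2r truncn_le.
exists (k + c k)%N; first by apply/eqP; rewrite -leqn0 -(subnn (c k)) decay_sub.
have ck : (c k)%:R <= N%:R / u%:R :> R.
  apply: le_trans (decay_expR k) _; rewrite ler_pM2l //.
  rewrite -[leRHS]lnK ?posrE ?invr_gt0 // ler_expR lnV ?posrE //.
  by rewrite lerN2 ler_pdivlMr // [leLHS]mulrC [leRHS]mulrC -ler_pdivrMr.
rewrite natrD mulrDr mulr1 mulrDl -/x; lra.
Qed.

(** The first translate already brings the codimension down to [N - u]. *)
Lemma decay_linear : exists2 m, c m = 0%N & m%:R <= N%:R - u%:R + 1 :> R.
Proof.
exists (1 + (N - u))%N; last by rewrite natrD natrB // addrC lexx.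
have := decay_sub 1 (N - u); have := cS 0; rewrite c0; nia.
Qed.
End Decay.

(** * Greedy choice of the translates *)

Section Greedy.
Variables (R : realType) (H : groupType) (V : vectType R[i]).
Variables (form : {dot V for Num.conj}) (rho : H -> 'End(V)) (U : {vspace V}).
Hypotheses (rho_rep : representation rho) (rho_unitary : unitary form rho).
Hypothesis rho_irr : irreducible rho.

Lemma greedy_codim : exists c : nat -> nat, [/\ c 0%N = \dim {:V},
  forall k, (c k.+1 * \dim {:V} <= c k * (\dim {:V} - \dim U))%N &
  forall k, c k = 0%N -> (diam_add rho U <= k%:R%:E)%E].
Proof.
have [g gP] := choice (fun W =>
  exists_large_translate rho_rep rho_unitary rho_irr W U).
pose W := fix W k := if k is k'.+1 then (W k' + rho (g (W k')) @: U)%VS else 0%VS.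
have WE k : W k = (\sum_(i < k) rho (g (W i)) @: U)%VS.
  by elim: k => [|k IH]; rewrite ?big_ord0 // big_ord_recr /= -IH.
exists (fun k => \dim {:V} - \dim (W k))%N; split=> [|k|k /eqP].
- by rewrite /= dimv0 subn0.
- exact: gP.
- rewrite subn_eq0 => W_full; apply: ereal_inf_lbound; exists k => //.
  exists (fun i => g (W i)); rewrite -WE; apply/eqP.
  by rewrite eqEdim subvf.
Qed.
End Greedy.

Theorem theorem2 (R : realType) (K : topologicalGroupType)
    (V : vectType R[i]) (form : {dot V for Num.conj})
    (rho : K -> 'End(V)) (U : {vspace V}) (N u : nat) :
  compact [set: K] ->
  representation rho ->
  continuous_representation rho ->
  unitary form rho ->
  irreducible rho ->
  N = \dim {:V} ->
  (2 <= N)%N ->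
  U != 0%VS ->
  u = \dim U ->
  (diam_add rho U <=
     (Num.min (Num.ceil (N%:R * ln N%:R / u%:R : R))%:~R
        (Num.min (N%:R * (1 + ln u%:R) / u%:R + 1)
                 (N%:R - u%:R + 1)))%:E)%E.
Proof.
move=> _ rho_rep _ rho_unitary rho_irr -> N2 U0 ->.
have [c [c0 cS c_diam]] := greedy_codim U rho_rep rho_unitary rho_irr.
have u_gt0 : (0 < \dim U)%N by rewrite lt0n dimv_eq0.
have u_le : (\dim U <= \dim {:V})%N by rewrite dimvS ?subvf.
have diam_le (x : R) : (exists2 m, c m = 0%N & m%:R <= x) ->
    (diam_add rho U <= x%:E)%E.
  by move=> [m /c_diam dm mx]; apply: le_trans dm _; rewrite lee_fin.
have le1 := diam_le _ (decay_ceil R u_gt0 u_le c0 cS N2).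
have le2 := diam_le _ (decay_ln R u_gt0 u_le c0 cS).
have le3 := diam_le _ (decay_linear R u_gt0 u_le c0 cS).
by rewrite !EFin_min !le_min le1 le2 le3.
Qed.
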